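(* Let $(X,d)$ be a complete metric space, let $\mathcal{F}=\{w_1,\dots,w_N\}$ be an IFS consisting of Browder contractions on $X$, and let $A$ be the attractor of $\mathcal{F}$. Let $\sigma=(\sigma_n)_{n=1}^\infty\in\{1,\dots,N\}^\infty$ be a disjunctive sequence and let $x_0\in X$. Define $x_n=w_{\sigma_n}(x_{n-1})$ for $n\ge1$. Then $$\omega((x_n)):=\bigcap_{m=0}^\infty\overline{\{x_n:n\ge m\}}=A .$$
   Context: A map $f:X\to X$ is a Browder contraction if there is a nondecreasing right continuous $\varphi:[0,\infty)\to[0,\infty)$ with $\varphi(t)<t$ for $t>0$ and $d(f(x),f(y))\le\varphi(d(x,y))$ for all $x,y\in X$. $\mathcal{K}(X)$ is the set of nonempty compact subsets of $X$ with the Hausdorff metric. The Hutchinson operator is $\mathcal{F}(K)=\bigcup_{i=1}^N w_i(K)$. The attractor of $\mathcal{F}$ is the set $A\in\mathcal{K}(X)$ with $\mathcal{F}(A)=A$ and $\mathcal{F}^k(K)\to A$ for every $K\in\mathcal{K}(X)$ (for Browder contractions on a nonempty complete metric space it exists and is unique). A sequence $\sigma\in I^\infty$ over a finite alphabet $I$ is disjunctive if every finite word $\alpha\in I^k$, $k\ge1$, appears in $\sigma$: $(\sigma_n,\dots,\sigma_{n+k-1})=\alpha$ for some $n\ge1$. *)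

(* Defs.v *)
From HB Require Import structures.
From mathcomp Require Import all_boot all_order all_algebra.
From mathcomp Require Import all_classical all_reals.
From mathcomp Require Import topology normedtype sequences.

Set Implicit Arguments.
Unset Strict Implicit.
Unset Printing Implicit Defensive.

Import Order.TTheory GRing.Theory Num.Theory.
Import numFieldNormedType.Exports.

Local Open Scope classical_set_scope.
Local Open Scope ring_scope.

#[short(type="completeMetricType")]
HB.structure Definition CompleteMetric (K : numDomainType) :=
  { M of Metric K M & Complete M }.

(* [phi] is only used on [0, +oo[; every condition below is restricted to
   that half-line, and the right neighbourhoods of t >= 0 lie inside it. *)
Definition Browder_contraction (R : realType) (X : metricType R)
    (f : X -> X) : Prop :=
  exists phi : R -> R,
    [/\ forall t, 0 <= t -> 0 <= phi t,
        forall s t, 0 <= s -> s <= t -> phi s <= phi t,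
        forall t, 0 <= t -> phi @ t^'+ --> phi t,
        forall t, 0 < t -> phi t < t &
        forall x y, mdist (f x) (f y) <= phi (mdist x y)].

Definition nonempty_compacts (X : topologicalType) : set (set X) :=
  [set K | K !=set0 /\ compact K].

(* The real-valued [inf] and [sup] are 0 on empty or unbounded sets; on
   [nonempty_compacts] all the sets involved are nonempty and bounded. *)
Definition dist_to_set (R : realType) (X : metricType R)
    (x : X) (B : set X) : R :=
  inf [set mdist x y | y in B].

Definition hausdorff_dist (R : realType) (X : metricType R)
    (A B : set X) : R :=
  Num.max (sup [set dist_to_set a B | a in A])
          (sup [set dist_to_set b A | b in B]).

Definition hutchinson (X : Type) (N : nat) (w : 'I_N -> X -> X)
    (K : set X) : set X :=
  \bigcup_(i in [set: 'I_N]) (w i @` K).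

(* Convergence in the space of nonempty compact sets is convergence to 0 of
   the Hausdorff distance. *)
Definition is_attractor (R : realType) (X : metricType R) (N : nat)
    (w : 'I_N -> X -> X) (A : set X) : Prop :=
  [/\ nonempty_compacts A,
      hutchinson w A = A &
      forall K : set X, nonempty_compacts K ->
        hausdorff_dist (iter k (hutchinson w) K) A @[k --> \oo] --> (0 : R)].

(* Sequences are indexed from 0: [sigma n] is the (n+1)-st letter. *)
Definition disjunctive (I : finType) (sigma : nat -> I) : Prop :=
  forall (k : nat) (alpha : k.-tuple I), (1 <= k)%N ->
    exists n : nat, forall j : 'I_k, sigma (n + j)%N = tnth alpha j.

Definition omega_limit (X : topologicalType) (x : nat -> X) : set X :=
  \bigcap_m closure [set x n | n in [set n | (m <= n)%N]].

(* Main.v *)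
Require Import Defs.
From mathcomp Require Import all_boot all_order all_algebra.
From mathcomp Require Import all_classical all_reals.
From mathcomp Require Import topology normedtype sequences.

(** Compositions of n maps of the system shrink a bounded set to diameter at
    most phi^n(D), uniformly in the choice of the maps, and phi^n(D) -> 0.
    Comparing the orbit with the one driven by the same letters from a point of
    A shows that the distance from x_n to A tends to 0, so limit points lie in
    the closed set A.  Conversely a point a of A is w_{s_k} o ... o w_{s_1} (b)
    with b in A and k as large as we like; the word s_1 ... s_k occurs
    arbitrarily far in sigma, and reading it sends some x_n close to a because
    the distance from x_n to b is bounded independently of n. *)

Set Implicit Arguments.
Unset Strict Implicit.
Unset Printing Implicit Defensive.

Import Order.TTheory GRing.Theory Num.Theory.
Import numFieldNormedType.Exports.

Local Open Scope classical_set_scope.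
Local Open Scope ring_scope.

Lemma compact_mdist_bounded (R : realType) (X : metricType R) (A : set X)
    (y : X) : compact A -> exists D, forall z, A z -> mdist y z <= D.
Proof.
move=> /compact_near_coveringP cA.
suff : \forall D \near +oo, A `<=` [set z | mdist y z <= D].
  by case/filter_ex => D AD; exists D.
apply: cA => z Az.
(* One [D] has to serve a whole neighbourhood of [z]; on the unit ball every [D] above
   [mdist y z + 1] does. *)
exists (ball z 1, [set D | mdist y z + 1 < D]) => /=.
  split; first exact: nbhsx_ballx.
  by exists (mdist y z + 1); split => //; exact: num_real.
move=> [z' D] /= []; rewrite ballEmdist /= => zz' yzD.
apply: le_trans (ltW yzD); apply: le_trans (metric_triangle _ z _) _.
by rewrite lerD2l ltW.
Qed.

Lemma mem_closed_mdist (R : realType) (X : metricType R) (A : set X) (a : X) :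
  closed A -> (forall e, 0 < e -> exists2 b, A b & mdist a b < e) -> A a.
Proof.
move=> clA Aa; apply: clA => B /nbhs_ballP[e /= e0 eB].
by have [b Ab abe] := Aa _ e0; exists b; split=> //; apply: eB; rewrite ballEmdist.
Qed.

(* Right continuity of the maximum is only needed in the form of the fourth
   item, which passes to finite families at once. *)
Lemma Browder_common_modulus (R : realType) (X : metricType R) (I : finType)
    (w : I -> X -> X) : (forall i, Browder_contraction (w i)) ->
  exists phi : R -> R,
    [/\ forall t, 0 <= phi t,
        forall s t, 0 <= s -> s <= t -> phi s <= phi t,
        forall t, 0 < t -> phi t < t,
        forall t, 0 < t -> \forall s \near t^'+, phi s < t &
        forall i y z, mdist (w i y) (w i z) <= phi (mdist y z)].
Proof.
move=> hw; have [f fP] := choice hw.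
(* The default 0 of the maximum makes the modulus nonnegative on the whole line and covers an empty
   family. *)
exists (fun t => \big[Order.max/0]_i f i t); split.
- by move=> t; exact: bigmax_ge_id.
- by move=> s t s0 st; apply: le_bigmax2 => i _; have [_ + _ _ _] := fP i; exact.
- by move=> t t0; apply: bigmax_lt => // i _; have [_ _ _ + _] := fP i; exact.
- move=> t t0; have : \forall s \near t^'+, forall i, f i s < t.
    apply: filter_forall => i; have [_ _ cf ltf _] := fP i.
    exact: cvgr_lt (cf t (ltW t0)) _ (ltf t t0).
  by apply: filterS => s fst; exact: bigmax_lt.
- move=> i y z; have [_ _ _ _ /(_ y z)/le_trans] := fP i; apply.
  exact: (le_bigmax _ (fun j => f j (mdist y z))).
Qed.

(** Were all iterates at least [e], their infimum L would be positive. Since [phi] is below L both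
    at L and just to the right of it, an iterate close enough to L is followed by one below L. *)
Lemma iter_modulus_lt (R : realType) (phi : R -> R) (D e : R) :
    (forall t, 0 < t -> phi t < t) ->
    (forall t, 0 < t -> \forall s \near t^'+, phi s < t) -> 0 < e ->
  exists k, iter k phi D < e.
Proof.
move=> ltphi phir e0; apply/not_existsP => itge.
have {}itge k : e <= iter k phi D by rewrite leNgt; apply/negP/itge.
pose S := range (fun k => iter k phi D); pose L := inf S.
have S0 : S !=set0 by exists D, 0%N.
have lbS : has_lbound S by exists e => _ [k _ <-].
have L0 : 0 < L by apply: lt_le_trans e0 _; apply: lb_le_inf => // _ [k _ <-].
have leL k : L <= iter k phi D by apply: ge_inf => //; exists k.
have [d /= d0 dL] := phir L L0.
have [|_ [k _ <-] kd] := @inf_lt _ S (L + d) S0; first by rewrite ltrDl.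
have := leL k.+1; rewrite leNgt /= => /negP; apply.
have := leL k; rewrite le_eqVlt => /predU1P[<-|Lk]; first exact: ltphi.
by apply: dL => //=; rewrite distrC ger0_norm ?subr_ge0 1?ltW// ltrBlDl.
Qed.

Lemma iter_modulus_le (R : realType) (phi : R -> R) (D : R) (k n : nat) :
    (forall t, 0 <= phi t) ->
    (forall s t, 0 <= s -> s <= t -> phi s <= phi t) ->
    (forall t, 0 < t -> phi t < t) -> 0 <= D -> (k <= n)%N ->
  iter n phi D <= iter k phi D.
Proof.
move=> phi0 mphi ltphi D0 kn.
have le_phi t : 0 <= t -> phi t <= t.
  rewrite le_eqVlt => /predU1P[<-|/ltphi/ltW //].
  (* At t = 0: if [phi 0] were positive, then [phi (phi 0) < phi 0], against monotonicity. *)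
  rewrite leNgt; apply/negP => /[dup] p0 /ltphi.
  by rewrite ltNge mphi// ltW.
rewrite -(subnK kn); elim: (n - k)%N => //= i; apply: le_trans.
by apply: le_phi; case: (i + k)%N => /=.
Qed.

(** [foldl] makes the first letter act first, in the order in which the orbit reads [sigma]. *)
Definition word_map (I X : Type) (w : I -> X -> X) (s : seq I) (y : X) : X :=
  foldl (fun z i => w i z) y s.

Lemma mdist_word_map (R : realType) (X : metricType R) (I : Type)
    (w : I -> X -> X) (phi : R -> R) (s : seq I) (y z : X) (D : R) :
    (forall u v, 0 <= u -> u <= v -> phi u <= phi v) ->
    (forall i y z, mdist (w i y) (w i z) <= phi (mdist y z)) ->
  mdist y z <= D ->
  mdist (word_map w s y) (word_map w s z) <= iter (size s) phi D.
Proof.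
move=> mphi hphi; elim: s y z D => [|i s IH] y z D yzD //=.
rewrite -iterS iterSr; apply: IH.
by apply: le_trans (hphi i y z) _; apply: mphi => //; exact: mdist_ge0.
Qed.

Lemma word_map_orbit (I X : Type) (w : I -> X -> X) (sigma : nat -> I)
    (x : nat -> X) : (forall n, x n.+1 = w (sigma n) (x n)) ->
  forall n k, x (n + k)%N = word_map w (mkseq (fun j => sigma (n + j)%N) k) (x n).
Proof.
move=> xS n; elim=> [|k IH]; first by rewrite addn0.
by rewrite addnS xS IH /mkseq /word_map -addn1 iotaD map_cat foldl_cat.
Qed.

Lemma word_map_invariant (X : Type) (N : nat) (w : 'I_N -> X -> X) (A : set X)
    (s : seq 'I_N) (a : X) :
  hutchinson w A = A -> A a -> A (word_map w s a).
Proof.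
move=> FA; elim: s a => [|i s IH] a Aa //=.
by apply: IH; rewrite -FA; exists i => //; exists a.
Qed.

(** The word is built from its end: writing a as the image of some a' in A under [w i] makes i the
    last letter, hence [rcons], and the induction goes on with a'. *)
Lemma word_map_preimage (X : Type) (N : nat) (w : 'I_N -> X -> X) (A : set X)
    (k : nat) (a : X) : hutchinson w A = A -> A a ->
  exists s b, [/\ size s = k, A b & a = word_map w s b].
Proof.
move=> FA; elim: k a => [|k IH] a Aa; first by exists [::], a.
move: Aa; rewrite -{1}FA => -[i _ [a' Aa' <-]].
have [s [b [sk Ab ->]]] := IH _ Aa'.
by exists (rcons s i), b; rewrite size_rcons sk /word_map foldl_rcons.
Qed.

(* Prefixing [s] with [m] arbitrary letters pushes the occurrence beyond [m]. *)
Lemma disjunctive_late (I : finType) (sigma : nat -> I) (m : nat) (s : seq I) :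
  disjunctive sigma ->
  exists2 n, (m <= n)%N & mkseq (fun j => sigma (n + j)%N) (size s) = s.
Proof.
move=> ds; case: s => [|i s0]; first by exists m.
set s := i :: s0; pose t := nseq m i ++ s.
have t0 : (0 < size t)%N by rewrite size_cat addnS.
have [n hn] := ds _ (in_tuple t) t0.
exists (n + m)%N; first exact: leq_addl.
apply: (@eq_from_nth _ i); rewrite size_mkseq // => j js.
have jt : (m + j < size t)%N by rewrite size_cat size_nseq ltn_add2l.
have := hn (Ordinal jt); rewrite nth_mkseq // -addnA /= => ->.
by rewrite (tnth_nth i) /= nth_cat size_nseq ltnNge leq_addr addKn.
Qed.

Theorem theorem5p5 (R : realType) (X : completeMetricType R) (N : nat)
    (w : 'I_N -> X -> X) (A : set X) (sigma : nat -> 'I_N)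
    (x0 : X) (x : nat -> X)
    (hw : forall i : 'I_N, Browder_contraction (w i))
    (hA : is_attractor w A)
    (hsigma : disjunctive sigma)
    (hx0 : x 0%N = x0)
    (hxS : forall n : nat, x n.+1 = w (sigma n) (x n)) :
  omega_limit x = A.
Proof.
have [phi [phi0 mphi ltphi phir hphi]] := Browder_common_modulus hw.
have [[[a0 Aa0] cA] FA _] := hA.
pose D0 := mdist (x 0%N) a0.
pose y n := word_map w (mkseq (fun j => sigma (0 + j)%N) n) a0.
have Ay n : A (y n) by exact: word_map_invariant.
have xy n : mdist (x n) (y n) <= iter n phi D0.
  rewrite -[in x n](add0n n) (word_map_orbit hxS).
  by rewrite -[n in leRHS](size_mkseq (fun j => sigma (0 + j)%N)) mdist_word_map.
have itD0 k n : (k <= n)%N -> iter n phi D0 <= iter k phi D0.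
  by move=> kn; apply: iter_modulus_le => //; exact: mdist_ge0.
apply/seteqP; split => a.
  move=> oa; apply: mem_closed_mdist.
    by apply: compact_closed cA; exact: metric_hausdorff.
  move=> e e0; have e20 : 0 < e / 2 by rewrite divr_gt0.
  (* From index [k] on, the orbit is within e/2 of its shadow [y n] in A; the closure of that tail
     supplies an [x n] within e/2 of [a]. *)
  have [k ke] := iter_modulus_lt D0 ltphi phir e20.
  have [_ [[n /= kn <-]]] := oa k I _ (nbhsx_ballx a _ e20).
  rewrite ballEmdist /= => axn; exists (y n) => //.
  rewrite (splitr e); apply: le_lt_trans (metric_triangle _ (x n) _) _.
  by apply: ltrD axn _; apply: le_lt_trans (le_trans (xy n) (itD0 _ _ kn)) ke.
move=> Aa m _ B /nbhs_ballP[e /= e0 eB].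
have [D1 hD1] := compact_mdist_bounded a0 cA.
(* The constant bounds the distance from [x n] to any b in A along the path [x n], [y n], [a0], b.
   It does not depend on n, so the length [k] and the word can be fixed before the place n where the
   word occurs. *)
have [k ke] := iter_modulus_lt (D0 + (D1 + D1)) ltphi phir e0.
have [s [b [sk Ab ab]]] := word_map_preimage k FA Aa.
have [n mn hs] := disjunctive_late m s hsigma.
exists (x (n + k)%N); split.
  by exists (n + k)%N => //=; apply: leq_trans mn (leq_addr _ _).
apply: eB; rewrite ballEmdist /= (word_map_orbit hxS) -sk hs ab.
apply: le_lt_trans ke; rewrite -sk; apply: mdist_word_map => //.
rewrite metric_sym; apply: le_trans (metric_triangle _ (y n) _) _.
apply: lerD; first exact: le_trans (xy n) (itD0 0%N n (leq0n n)).
apply: le_trans (metric_triangle _ a0 _) _.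
by rewrite [mdist (y n) a0]metric_sym lerD ?hD1.
Qed.
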